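(* Let $R$ be a finite commutative ring with unity $1$ and zero element $0\neq 1$, with the discrete topology, let $\Gamma$ be a set with at least two elements, let $\varphi:\Gamma\to\Gamma$ be an arbitrary map and let $\mathfrak{w}=(\mathfrak{w}_\alpha)_{\alpha\in\Gamma}\in R^\Gamma$. Let $\sigma_{\varphi,\mathfrak{w}}:R^\Gamma\to R^\Gamma$ be the weighted generalized shift $\sigma_{\varphi,\mathfrak{w}}((x_\alpha)_{\alpha\in\Gamma})=(\mathfrak{w}_\alpha x_{\varphi(\alpha)})_{\alpha\in\Gamma}$. Then the following statements are equivalent: (i) $(R^\Gamma,\sigma_{\varphi,\mathfrak{w}})$ is Devaney chaotic; (ii) $(R^\Gamma,\sigma_{\varphi,\mathfrak{w}})$ is topological transitive; (iii) $\varphi$ is one-to-one without any periodic point, and $\mathfrak{w}_\alpha$ is invertible for each $\alpha\in\Gamma$.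
   Context: $R^\Gamma$ carries the product topology; it is compact Hausdorff, and its unique compatible uniform structure is $\mathcal{K}=\{\mathcal{O}\subseteq R^\Gamma\times R^\Gamma:$ there is a finite $M\subseteq\Gamma$ with $\mathcal{O}_M\subseteq\mathcal{O}\}$, where $\mathcal{O}_M=\{(x,y)\in R^\Gamma\times R^\Gamma: x_\alpha=y_\alpha \text{ for all }\alpha\in M\}$. A point $a$ is a periodic point of a self-map $h:A\to A$ if $h^n(a)=a$ for some $n\geq 1$; $Per(h)$ is the set of periodic points of $h$. Let $X$ be a compact Hausdorff space with its unique compatible uniform structure $\mathcal{F}$, and $f:X\to X$ continuous. - $(X,f)$ is topological transitive if for all nonempty open subsets $U,V$ of $X$ there exists $n\geq 1$ with $f^n(U)\cap V\neq\varnothing$. - $(X,f)$ is sensitive if there exists $\mathcal{O}\in\mathcal{F}$ such that for every $x\in X$ and every open neighbourhood $U$ of $x$ there exist $y\in U$ and $n\geq 0$ with $(f^n(x),f^n(y))\notin\mathcal{O}$. - $(X,f)$ is Devaney chaotic if it is sensitive, topological transitive, and $Per(f)$ is dense in $X$. *)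

(* Defs.v *)
From mathcomp Require Import all_boot all_order all_algebra finmap.
From mathcomp Require Import mathcomp_extra boolp classical_sets cardinality topology.

Set Implicit Arguments.
Unset Strict Implicit.
Unset Printing Implicit Defensive.

Import GRing.Theory.
Local Open Scope classical_set_scope.

Definition periodic_points (T : Type) (h : T -> T) : set T :=
  [set a | exists2 n, (1 <= n)%N & iter n h a = a].

Section Dynamics.

(* Only the uniformity is needed to state these notions; they are meant for a
   continuous self-map of a compact Hausdorff space, whose compatible
   uniformity is unique. *)
Variables (X : uniformType) (f : X -> X).

Definition topological_transitive : Prop :=
  forall U V : set X, open U -> U !=set0 -> open V -> V !=set0 ->
  exists2 n, (1 <= n)%N & (iter n f @` U) `&` V !=set0.

Definition sensitive : Prop :=
  exists2 O : set (X * X), entourage O &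
    forall (x : X) (U : set X), open_nbhs x U ->
      exists y n, U y /\ ~ O (iter n f x, iter n f y).

Definition devaney_chaotic : Prop :=
  [/\ sensitive, topological_transitive & dense (periodic_points f)].

End Dynamics.

Section WeightedShift.

Variables (R : finComUnitRingType) (Gamma : Type).

Definition config : uniformType := {ptws Gamma -> discrete_topology R}.

Definition weighted_shift (phi : Gamma -> Gamma) (w : Gamma -> R)
    (x : config) : config :=
  fun a => (w a * (x (phi a) : R))%R.

Lemma config_hausdorff : hausdorff_space config.
Proof.
apply: (@hausdorff_product {classic Gamma} (fun=> discrete_topology R)) => _.
exact: discrete_hausdorff.
Qed.

Lemma config_compact : compact [set: config].
Proof.
have := @tychonoff {classic Gamma} (fun=> discrete_topology R) (fun=> setT).
move=> H; have -> : [set: config] = [set g | forall i, setT (g i)].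
  by apply/seteqP; split.
apply: H => _; apply: finite_compact; exact: (@finite_finset R).
Qed.

Lemma entourage_configP (E : set (config * config)) :
  entourage E <->
  exists2 M : set Gamma, finite_set M &
    [set xy : config * config | forall a, M a -> xy.1 a = xy.2 a] `<=` E.
Proof.
split=> [[_ [F _ <-] subE]|[M finM ME]]; last first.
  have entF : Filter (@entourage config) by exact: entourage_filter.
  have /finite_fsetP[F MF] : @finite_set {classic Gamma} M := finM.
  have entM : @entourage config (\bigcap_(a in [set` F])
      [set xy | xy.1 a = xy.2 a]).
    apply: filter_bigI => a aF.
    have entI : @entourage (initial_topology (@proj Gamma
        (fun=> discrete_topology R) a)) [set xy | xy.1 a = xy.2 a].
      exists [set xy | xy.1 = xy.2] => //.
      by rewrite uniform_discrete => -[x y] /= [z _ [<- <-]].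
    pose p : {classic Gamma} * set (config * config) :=
      (a, [set xy | xy.1 a = xy.2 a]).
    exists p.2 => //.
    exists (fset1 (exist _ p (asboolT entI))) => [? _|]; first by rewrite in_setE.
    by rewrite set_fset1 bigcap_set1.
  apply: (@filterS _ _ entF _ _ _ entM) => xy /= xyF; apply: ME => a Ma.
  apply: xyF.
  by rewrite -MF.
exists [set (projT1 p).1 | p in [set` F]]; first exact: finite_image.
move=> [x y] /= xyM; apply: subE => p pF.
have /asboolP[V entV sV] := projT2 p.
apply: sV; change (V (x (projT1 p).1, y (projT1 p).1)).
by rewrite (xyM (projT1 p).1); [exact: entourage_refl|exists p].
Qed.

Lemma weighted_shift_continuous phi w : continuous (weighted_shift phi w).
Proof.
move=> x.
have FF : Filter (weighted_shift phi w @ x).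
  by apply: fmap_filter; exact: nbhs_filter.
apply/(@cvg_sup _ _ _ _ _ FF) => a; move: {FF} x.
apply: continuous_comp_initial => x.
apply: (@continuous_comp _ _ _ (fun x : config => x (phi a))
  (fun r : discrete_topology R => (w a * (r : R))%R : discrete_topology R)).
  exact: (@proj_continuous {classic Gamma} (fun=> discrete_topology R)).
by move=> A; rewrite nbhs_simpl nbhs_principalE => /principal_filterP ?;
  apply/principal_filterP.
Qed.

End WeightedShift.

(* Main.v *)
Require Import Defs.
From mathcomp Require Import all_boot all_order all_algebra.
From mathcomp Require Import boolp classical_sets topology.
From mathcomp Require cardinality.
Import GRing.Theory.
Local Open Scope classical_set_scope.

Set Implicit Arguments.
Unset Strict Implicit.

(** The iterates of a weighted shift are again weighted shifts:
    sigma^n x at a is w_a w_(phi a) ... w_(phi^(n-1) a) x_(phi^n a).  If phi is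
    injective without periodic points and the weights are units, then for a
    finite set M of coordinates the sets phi^n M are disjoint from M for large n,
    so the coordinates of x and of sigma^n x in M can be prescribed
    independently, which gives transitivity and sensitivity; and values on M
    propagate uniquely along the phi^n-orbits to a fixed point of sigma^n.
    Conversely, transitivity forces the values of sigma x at any two coordinates
    to be arbitrary, whence units and injectivity, while a periodic orbit of phi
    would make vanishing on that orbit an invariant open condition. *)

(** * Orbits of an injective map without periodic points *)

Lemma iter_inj (T : Type) (f : T -> T) n : injective f -> injective (iter n f).
Proof. by move=> f_inj; elim: n => // n IHn x y /f_inj /IHn. Qed.

Lemma aperiodic_iter_eq (T : Type) (f : T -> T) (m n : nat) (a : T) :
  injective f -> periodic_points f = set0 -> iter m f a = iter n f a -> m = n.
Proof.
move=> f_inj f_aper.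
wlog le_mn : m n / (m <= n)%N.
  by move=> H; case/orP: (leq_total m n) => /H // {}H /esym /H.
move=> E; apply/eqP; rewrite eqn_leq le_mn /= leqNgt; apply/negP => lt_mn.
have : periodic_points f a.
  exists (n - m)%N; first by rewrite subn_gt0.
  by apply: (iter_inj (n := m) f_inj); rewrite -iterD subnKC.
by rewrite f_aper.
Qed.

(** A given point is reached from a given start at no more than one time, so the finitely many pairs
    from [s] rule out only finitely many [n]. *)
Lemma aperiodic_escape (T : eqType) (f : T -> T) (s : seq T) :
  injective f -> periodic_points f = set0 ->
  exists N, forall n a, (N <= n)%N -> a \in s -> iter n f a \notin s.
Proof.
move=> f_inj f_aper.
have /choice[N NP] (ab : T * T) :
    exists N, forall n, (N <= n)%N -> iter n f ab.1 <> ab.2.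
  have [[k fk]|no_k] := pselect (exists k, iter k f ab.1 = ab.2).
    exists k.+1 => n lt_kn fn; rewrite -fk in fn.
    by have E := aperiodic_iter_eq f_inj f_aper fn; rewrite E ltnn in lt_kn.
  by exists 0%N => n _ fn; apply: no_k; exists n.
exists (\max_(ab <- allpairs pair s s) N ab)%N => n a leNn a_s.
apply/negP => fa_s; apply: (NP (a, iter n f a) n) => //=.
by apply: leq_trans leNn; apply: leq_bigmax_seq => //; apply: allpairs_f.
Qed.

(** * Cylinders as basic neighbourhoods *)

Section Cylinders.
Variables (R : finComUnitRingType) (Gamma : Type).
Local Notation config := (config R Gamma).

Definition cylinder (s : seq {classic Gamma}) (x : config) : set config :=
  [set y | forall a, a \in s -> y a = x a].

Lemma nbhs_configP (x : config) (U : set config) :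
  nbhs x U <-> exists s, cylinder s x `<=` U.
Proof.
split=> [|[s sU]].
  rewrite -nbhs_entourageE => -[E /entourage_configP[M finM ME] EU].
  have /cardinality.finite_seqP[s Ms] :
    @cardinality.finite_set {classic Gamma} M := finM.
  exists s => y sxy; apply: EU; apply/mem_set; apply: ME => a /= Ma.
  by apply/esym/sxy; rewrite Ms in Ma.
rewrite -nbhs_entourageE.
exists [set xy : config * config | forall a : {classic Gamma}, a \in s -> xy.1 a = xy.2 a].
  apply/entourage_configP; exists [set a | (a : {classic Gamma}) \in s] => //.
  by apply: (@cardinality.finite_seq {classic Gamma}).
by move=> y /set_mem /= xy; apply: sU => a /xy.
Qed.

Lemma open_cylinder s x : open (cylinder s x).
Proof.
rewrite openE => y yx; apply/nbhs_configP; exists s => z zy a a_s.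
by rewrite zy // yx.
Qed.

Lemma cylinder_refl s x : cylinder s x x. Proof. by []. Qed.

Lemma transitive_cylinderP (f : config -> config) :
  topological_transitive f <->
  forall s t (u v : config), exists n x,
    cylinder s u x /\ cylinder t v (iter n.+1 f x).
Proof.
split=> [f_tr s t u v|f_tr U V].
  have [||||[//|n] _ [_ [[x xu <-] xv]]] := f_tr (cylinder s u) (cylinder t v).
  - exact: open_cylinder.
  - by exists u; exact: cylinder_refl.
  - exact: open_cylinder.
  - by exists v; exact: cylinder_refl.
  by exists n, x.
rewrite !openE => oU [u /oU /nbhs_configP[s sU]] oV [v /oV /nbhs_configP[t tV]].
have [n [x [xu xv]]] := f_tr s t u v.
by exists n.+1 => //; exists (iter n.+1 f x); split; [exists x; [exact: sU|]|exact: tV].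
Qed.

End Cylinders.

(** * Iterates of a weighted shift *)

Section Shift.
Variables (R : finComUnitRingType) (Gamma : Type).
Variables (phi : Gamma -> Gamma) (w : Gamma -> R).
Local Open Scope ring_scope.
Local Notation config := (config R Gamma).
Local Notation sigma := (weighted_shift phi w).

Definition weight (n : nat) (a : Gamma) : R := \prod_(i < n) w (iter i phi a).

Lemma weightD m n a : weight (m + n) a = weight m a * weight n (iter m phi a).
Proof.
rewrite /weight big_split_ord /=; congr (_ * _).
by apply: eq_bigr => i _; rewrite addnC iterD.
Qed.

Lemma weight1 a : weight 1 a = w a.
Proof. by rewrite /weight big_ord1. Qed.

Lemma iter_weighted_shift n :
  iter n sigma = weighted_shift (iter n phi) (weight n).
Proof.
apply/funext => x; elim: n => [|n IHn]; apply/funext => a.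
  by rewrite /weighted_shift /weight big_ord0 mul1r.
by rewrite iterS IHn /weighted_shift iterSr (weightD 1 n) weight1 -mulrA.
Qed.

Lemma iter_weighted_shiftE n x a :
  iter n sigma x a = (weight n a * (x (iter n phi a) : R))%R.
Proof. by rewrite iter_weighted_shift. Qed.

Lemma weight_unit n a :
  (forall b, w b \is a GRing.unit) -> weight n a \is a GRing.unit.
Proof. by move=> wU; apply: rpred_prod => i _. Qed.

End Shift.

(** The fixed-point equation carries a value along an orbit in both directions, since the weights
    are units. An orbit meets [s] at most once, so the prescribed values never conflict; on orbits
    missing [s] the fixed point is 0. *)
Lemma weighted_shift_fixpoint (R : finComUnitRingType) (Gamma : Type)
    (phi : Gamma -> Gamma) (w : Gamma -> R) (s : seq {classic Gamma})
    (u : config R Gamma) :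
  injective phi -> (forall a, w a \is a GRing.unit) ->
  (forall n (a : {classic Gamma}), (1 <= n)%N -> a \in s ->
     (iter n phi a : {classic Gamma}) \notin s) ->
  exists2 x, weighted_shift phi w x = x & cylinder s u x.
Proof.
move=> phi_inj wU s_esc; have WU n a := weight_unit phi n a wU.
pose W := weight phi w; pose D := weightD phi w.
(* Cancelling [p] steps leaves [m = iter (q - p) phi m'], which [s_esc] allows only for [q = p]. *)
have meet_eq p q (m m' : {classic Gamma}) : (p <= q)%N -> m \in s -> m' \in s ->
    iter p phi m = iter q phi m' -> p = q /\ m = m'.
  move=> le_pq ms m's; rewrite -(subnKC le_pq) iterD => /(iter_inj phi_inj) mE.
  have [d0|] := posnP (q - p); first by rewrite d0 addn0 mE d0.
  by move=> /s_esc /(_ m's); rewrite -mE ms.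
(* The orbits of a and m meet at a point where the value t is compatible with
   both r at a and u m at m. *)
pose link (a : Gamma) (r : R) (m : {classic Gamma}) i j (t : R) :=
  [/\ m \in s, iter i phi a = iter j phi m, r = (W i a * t)%R
    & u m = (W j m * t)%R :> R].
have link_push k a r m i j t : link a r m i j t ->
    link a r m (i + k)%N (j + k)%N ((W k (iter i phi a))^-1 * t)%R.
  move=> [ms E rE uE]; split=> //.
  - by rewrite addnC iterD E -iterD addnC.
  - by rewrite /W D -mulrA mulVKr.
  - by rewrite /W D -mulrA E mulVKr.
pose val a r := exists m i j t, link a r m i j t.
(* Pushing each link by the other's [i] gives both the same meeting point; then [meet_eq] identifies
   [m] and [m'], and cancelling the unit at [m] identifies the two values of [t]. *)
have val_fun a r r' : val a r -> val a r' -> r = r'.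
  move=> [m [i [j [t lk]]]] [m' [i' [j' [t' lk']]]].
  have [ms E -> uE] := link_push i' _ _ _ _ _ _ lk.
  have [m's E' -> uE'] := link_push i _ _ _ _ _ _ lk'.
  have [jE mE] : (j + i' = j' + i)%N /\ m = m'.
    have EE : iter (j + i') phi m = iter (j' + i) phi m' by rewrite -E -E' addnC.
    have [/meet_eq|/ltnW/meet_eq H] := leqP (j + i') (j' + i); first exact.
    by have [] := H _ _ m's ms (esym EE).
  rewrite (addnC i'); congr (_ * _)%R.
  by apply: (mulrI (WU (j + i')%N m)); rewrite -/W -uE mE uE' jE.
have valS a r : val (phi a) r -> val a (w a * r)%R.
  move=> [m [i [j [t [ms E -> uE]]]]]; exists m, i.+1, j, t; split=> //.
    by rewrite iterSr.
  by rewrite mulrA -add1n /W D weight1.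
have val_phi a r : val a r -> exists r', val (phi a) r'.
  move=> [m [i [j [t /(link_push 1%N)]]]]; rewrite !addn1 => -[ms E _ uE].
  exists (W i (phi a) * ((W 1%N (iter i phi a))^-1 * t))%R.
  exists m, i, j.+1, ((W 1%N (iter i phi a))^-1 * t)%R; split=> //.
  by rewrite -iterSr.
(* By [valS] and [val_phi], [a] has a value exactly when [phi a] has one, so the default 0 is
   consistent with the fixed-point equation. *)
pose x a : R := xget 0%R (val a).
have xP a r : val a r -> val a (x a) by move=> v; apply: xgetI v.
exists x; last first.
  move=> m ms; have v : val m (u m).
    by exists m, 0%N, 0%N, (u m); split; rewrite // /W /weight big_ord0 mul1r.
  exact: val_fun (xP _ _ v) v.
apply/funext => a; rewrite /weighted_shift.
have [[r v]|no_val] := pselect (exists r, val (phi a) r).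
  by apply: val_fun (valS _ _ (xP _ _ v)) (xP _ _ (valS _ _ v)).
rewrite /x !xgetPN ?mulr0 // => r v; apply: no_val; last by exists r.
exact: val_phi v.
Qed.

Section Equivalence.
Variables (R : finComUnitRingType) (Gamma : Type).
Variables (phi : Gamma -> Gamma) (w : Gamma -> R).
Local Notation sigma := (weighted_shift phi w).

(** * Necessary conditions for transitivity *)

Section Transitive.
Hypothesis tr : topological_transitive sigma.

Lemma transitive_unit a : w a \is a GRing.unit.
Proof.
have [n [x [_ /(_ _ (mem_head _ _)) wx]]] :=
  iffLR (transitive_cylinderP sigma) tr [::] [:: a : {classic Gamma}]
    (fun=> 0%R) (fun=> 1%R).
(* The image at [a] equals 1 and has [w a] as a factor; this uses that at least one step is made. *)
by apply/unitrPr; exists (iter n sigma x (phi a)).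
Qed.

Lemma transitive_injective : injective phi.
Proof.
move=> a b phi_ab; apply: contrapT => ab.
pose a' : {classic Gamma} := a; pose b' : {classic Gamma} := b.
have [n [x [_ v]]] :=
  iffLR (transitive_cylinderP sigma) tr [::] [:: a'; b']
    (fun=> 0%R) (fun c : {classic Gamma} => (c == a')%:R%R).
have va := v a' (mem_head _ _); have vb : iter n.+1 sigma x b' = 0%R.
  by rewrite v ?inE ?eqxx ?orbT //; case: eqP => // /esym.
(* Both coordinates read the same entry of the [n]-th image: the 0 at [b] makes that entry vanish,
   against the 1 at [a]. *)
move: va vb; rewrite eqxx /= /weighted_shift phi_ab => wa.
rewrite -[X in _ = X](mulr0 (w b)) => /(mulrI (transitive_unit b)) x0.
by move: wa; rewrite x0 mulr0 => /esym/eqP; rewrite oner_eq0.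
Qed.

Lemma transitive_aperiodic : periodic_points phi = set0.
Proof.
rewrite -subset0 => a [p p1 pa].
pose s : seq {classic Gamma} := [seq iter i phi a | i <- iota 0 p].
have sS c : c \in s -> (phi c : {classic Gamma}) \in s.
  move=> /mapP[i]; rewrite mem_iota /= => lt_ip ->; rewrite -iterS.
  have [->|ne_ip] := eqVneq i.+1 p.
    by rewrite pa; apply/mapP; exists 0%N => //; rewrite mem_iota.
  by apply/mapP; exists i.+1 => //; rewrite mem_iota /= ltn_neqAle ne_ip.
have as_ : (a : {classic Gamma}) \in s.
  by apply/mapP; exists 0%N => //; rewrite mem_iota.
have [n [x [x0 /(_ _ (mem_head _ _)) x1]]] :=
  iffLR (transitive_cylinderP sigma) tr s [:: a : {classic Gamma}]
    (fun=> 0%R) (fun=> 1%R).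
have sI k : (iter k phi a : {classic Gamma}) \in s by elim: k => //= k /sS.
by move: x1; rewrite iter_weighted_shiftE x0 // mulr0 => /esym/eqP; rewrite oner_eq0.
Qed.

End Transitive.

(** * Devaney chaos from the conditions on [phi] and [w] *)

Section Aperiodic.
Hypotheses (phi_inj : injective phi) (phi_aper : periodic_points phi = set0).
Hypothesis wU : forall a, w a \is a GRing.unit.

Lemma aperiodic_transitive : topological_transitive sigma.
Proof.
apply/transitive_cylinderP => s t u v.
have [N sN] := aperiodic_escape (T := {classic Gamma}) (s ++ t) phi_inj phi_aper.
(* At [iter N.+1 phi a] with [a] in [t], a point outside [s], [x] takes the value that the shift
   turns into [v a]; injectivity makes [xget] recover [a]. *)
pose pre (b : Gamma) : set {classic Gamma} := [set a | a \in t /\ iter N.+1 phi a = b].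
pose x b : R := if (b : {classic Gamma}) \in s then u b else
  let a := xget (b : {classic Gamma}) (pre b) in ((weight phi w N.+1 a)^-1 * (v a : R))%R.
exists N, x; split=> [a a_s|a a_t]; first by rewrite /x a_s.
rewrite iter_weighted_shiftE /x.
have := sN N.+1 a (leqnSn N); rewrite !mem_cat a_t orbT => /(_ isT) /norP[/negbTE-> _].
have pa : pre (iter N.+1 phi a) a by [].
have [_ /(iter_inj phi_inj) ->] :=
  xgetI (iter N.+1 phi a : {classic Gamma}) pa.
by rewrite mulVKr // weight_unit.
Qed.

Lemma aperiodic_sensitive (a : Gamma) : sensitive sigma.
Proof.
exists [set xy : config R Gamma * config R Gamma | xy.1 a = xy.2 a].
  apply/entourage_configP; exists [set a]; first exact: cardinality.finite_set1.
  by move=> xy; apply.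
move=> x U /open_nbhs_nbhs /nbhs_configP[s sU].
(* The coordinate [a] joins the list so that its own [N]-th iterate is known to avoid [s]. *)
have [N sN] :=
  aperiodic_escape (T := {classic Gamma}) ((a : {classic Gamma}) :: s) phi_inj phi_aper.
pose c : {classic Gamma} := iter N phi a.
have c_s : c \notin s.
  have : c \notin (a : {classic Gamma}) :: s by apply: sN => //; apply: mem_head.
  by rewrite inE => /norP[].
(* Adding 1 at [c] stays in the cylinder and changes the [N]-th image at [a] by a unit. *)
exists (fun b : {classic Gamma} => (x b + (b == c)%:R)%R : R), N; split.
  apply: sU => b b_s /=; case: eqP => [bc|_]; last by rewrite addr0.
  by rewrite -bc b_s in c_s.
rewrite /= !iter_weighted_shiftE eqxx => /(mulrI (weight_unit _ _ _ wU)).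
by rewrite -[LHS]addr0 => /addrI /esym/eqP; rewrite oner_eq0.
Qed.

Lemma aperiodic_dense_periodic : dense (periodic_points sigma).
Proof.
move=> U [u Uu] openU.
have /nbhs_configP[s sU] : nbhs u U by apply: open_nbhs_nbhs.
have [N sN] := aperiodic_escape (T := {classic Gamma}) s phi_inj phi_aper.
(* Every positive iterate of [iter N.+1 phi] is an iterate of [phi] of order at least [N], hence
   moves [s] off itself; [N.+1] also keeps the period positive. *)
have [|a||x x_fix xu] := @weighted_shift_fixpoint R Gamma (iter N.+1 phi)
    (weight phi w N.+1) s u.
- exact: iter_inj.
- exact: weight_unit.
- move=> n a n1 a_s; rewrite -iterM; apply: sN => //.
  by rewrite (leq_trans (leqnSn N)) // leq_pmull.
by exists x; split; [exact: sU|exists N.+1 => //; rewrite iter_weighted_shift].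
Qed.

End Aperiodic.
End Equivalence.

Unset Implicit Arguments.
Set Strict Implicit.

Theorem theorem5p2 (R : finComUnitRingType) (Gamma : Type)
  (Gamma_ge2 : exists a b : Gamma, a <> b)
  (phi : Gamma -> Gamma) (w : Gamma -> R) :
  [<-> devaney_chaotic (weighted_shift phi w);
       topological_transitive (weighted_shift phi w);
       [/\ injective phi, periodic_points phi = set0
         & forall a : Gamma, w a \is a GRing.unit] ].
Proof.
tfae=> [[]//|tr|[phi_inj phi_aper wU]].
  split; [exact: transitive_injective tr|exact: transitive_aperiodic tr|].
  exact: transitive_unit tr.
have [a _] := Gamma_ge2.
split; [exact: aperiodic_sensitive|exact: aperiodic_transitive|].
exact: aperiodic_dense_periodic.
Qed.
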